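(* There exist instances of the SPMV problem with intersecting start and target segments $S$ and $T$ where any algorithm that does not move all robots of $\mathcal{R}_1$ and $\mathcal{R}_3$ at the same time requires a number of steps that is unbounded in $n$ and $m$.
   Context: The SPMV (Shortest Path Mutual Visibility) problem: given a simple polygon $P$ consisting of $m$ vertices and a set $\mathcal{R}=\{r_1,\dots,r_n\}$ of $n$ point robots, where each robot $r_i$ has a starting position $s_i$ and a target position $t_i$, move all robots from their starting positions to their target positions along their shortest paths $\pi_i$ within $P$ while keeping all robots mutually visible. Two robots are mutually visible if the closed line segment joining them is contained in $P$ (regarded as a closed region); robots are points and do not obstruct each other's view. The robots are independent, execute the same algorithm, cannot communicate with each other, and have full visibility of their environment. Here all starting positions lie on a line segment $S$ in $P$, all target positions lie on a line segment $T$ in $P$, and $S$ and $T$ intersect in a point $q$. An algorithm computes a schedule, which specifies for each robot at what moment it moves where (in a straight line from its current location) and at what speed; only constant movement speed is considered. A step is a maximal period of time during which no changes to the robots' speed or direction occur (a robot starting or stopping counts as a change). Regions: let $Q$ be the minimal, possibly degenerate, polygon within $P$ that includes $S$, $T$ and all shortest paths $\pi_i$. Let $s_1,\dots,s_n$ be ordered from top to bottom along $S$, and let $t_{i_1},\dots,t_{i_n}$ denote the target points ordered from top to bottom along $T$. Let $A_1$ be the simple polygon bounded by the two segments $(s_1,q)$ and $(t_{i_n},q)$ and the concave chain corresponding to the shortest path in $Q$ from $s_1$ to $t_{i_n}$. Symmetrically, $A_2$, $A_3$, $A_4$ are defined in the same way from the pairs $(s_1,t_{i_1})$, $(s_n,t_{i_1})$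 and $(s_n,t_{i_n})$, respectively (so $A_1$ and $A_3$ are opposite at $q$, and $A_2$ and $A_4$ are opposite at $q$). Each robot $r_i$ moving from $s_i$ to $t_i$ stays within one of the regions $A_1,\dots,A_4$ during its movement, and $\mathcal{R}_j$ ($1\le j\le 4$) denotes the set of robots of $\mathcal{R}$ moving through $A_j$; a robot that moves only along the boundary of two regions (not in their interior) can be assigned to either of the two corresponding sets. *)

(* Defs.v *)
From HB Require Import structures.
From mathcomp Require Import all_boot all_order all_algebra all_fingroup.
From mathcomp Require Import all_classical all_reals all_analysis.

Set Implicit Arguments.
Unset Strict Implicit.
Unset Printing Implicit Defensive.

Import Order.TTheory GRing.Theory Num.Theory.
Import numFieldNormedType.Exports.

Local Open Scope classical_set_scope.
Local Open Scope ring_scope.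

Section Geometry.
Variable R : realType.

Definition point : Type := (R^o * R^o)%type.

(* The canonical norm on a product is the max norm, so the Euclidean distance
   is written out. *)
Definition dist (x y : point) : R :=
  Num.sqrt ((x.1 - y.1) ^+ 2 + (x.2 - y.2) ^+ 2).

Definition segment (x y : point) : set point :=
  [set x + l *: (y - x) | l in `[0, 1]%classic].

(* The polygonal path through the points of x :: p. *)
Fixpoint trace (x : point) (p : seq point) : set point :=
  if p is y :: p' then segment x y `|` trace y p' else [set x].

Fixpoint len (x : point) (p : seq point) : R :=
  if p is y :: p' then dist x y + len y p' else 0.

(* Shortest paths in polygons are polygonal, so it is enough to compare
   polygonal paths. *)
Definition shortest_path (D : set point) (x y : point) (p : seq point) : Prop :=
  [/\ last x p = y, trace x p `<=` D &
      forall p', last x p' = y -> trace x p' `<=` D -> len x p <= len x p'].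

(* The closed region bounded by B: B together with the bounded connected
   components of its complement. *)
Definition fill (B : set point) : set point :=
  [set x | B x \/ bounded_set (connected_component (~` B) x)].

Definition edge m (v : 'I_m -> point) (i : 'I_m) : set point :=
  segment (v i) (v (ordS i)).

Definition polygon m (v : 'I_m -> point) : set point :=
  fill (\bigcup_i edge v i).

Definition simple_polygon m (v : 'I_m -> point) : Prop :=
  [/\ (2 < m)%N, injective v &
      forall (i j : 'I_m) x, i != j -> edge v i x -> edge v j x ->
        (j = ordS i /\ x = v j) \/ (i = ordS j /\ x = v i)].

(* A possibly degenerate polygon may have a boundary curve that touches or
   overlaps itself, hence no simplicity condition here. *)
Definition degenerate_polygon (D : set point) : Prop :=
  exists m (v : 'I_m.+1 -> point), D = polygon v.

(* The points u 0, u 1, ... lie on the segment from a to b, in this order. *)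
Definition ordered_along (a b : point) n (u : 'I_n -> point) : Prop :=
  (forall i, segment a b (u i)) /\
  (forall i j : 'I_n, (i <= j)%N -> segment a (u j) (u i)).

Definition visible (P : set point) (x y : point) : Prop := segment x y `<=` P.

End Geometry.

(* An instance with n robots in a simple polygon with m vertices, for
   intersecting start and target segments.  Robots are numbered by their order
   along S; torder lists them in the order of their targets along T.  Heights are
   second coordinates; a horizontal segment may be oriented either way. *)
Record instance (R : realType) (n m : nat) := Instance {
  vertex : 'I_m -> point R;
  S_top : point R; S_bot : point R;
  T_top : point R; T_bot : point R;
  crossing : point R;
  start : 'I_n -> point R;
  target : 'I_n -> point R;
  torder : {perm 'I_n};
  spath : 'I_n -> seq (point R);
  vertex_simple : simple_polygon vertex;
  S_segment : S_top != S_bot;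
  T_segment : T_top != T_bot;
  S_oriented : S_bot.2 <= S_top.2;
  T_oriented : T_bot.2 <= T_top.2;
  S_inside : segment S_top S_bot `<=` polygon vertex;
  T_inside : segment T_top T_bot `<=` polygon vertex;
  S_meets_T : segment S_top S_bot `&` segment T_top T_bot = [set crossing];
  start_ordered : ordered_along S_top S_bot start;
  target_ordered : ordered_along T_top T_bot (target \o torder);
  spath_shortest :
    forall i, shortest_path (polygon vertex) (start i) (target i) (spath i)
}.

Section Regions.
Variables (R : realType) (n m : nat) (I : instance R n.+1 m).

Definition route (i : 'I_n.+1) : set (point R) := trace (start I i) (spath I i).

(* "Minimal" is with respect to inclusion. *)
Definition is_Q (Q : set (point R)) : Prop :=
  let fits D := [/\ degenerate_polygon D, D `<=` polygon (vertex I),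
    segment (S_top I) (S_bot I) `<=` D, segment (T_top I) (T_bot I) `<=` D &
    forall i, route i `<=` D] in
  fits Q /\ forall D, fits D -> Q `<=` D.

Inductive region_name := A1 | A2 | A3 | A4.

Definition s_corner (j : region_name) : point R :=
  match j with
  | A1 | A2 => start I ord0
  | A3 | A4 => start I ord_max
  end.

Definition t_corner (j : region_name) : point R :=
  match j with
  | A2 | A3 => target I (torder I ord0)
  | A1 | A4 => target I (torder I ord_max)
  end.

Definition is_region (j : region_name) (A : set (point R)) : Prop :=
  exists Q c, [/\ is_Q Q, shortest_path Q (s_corner j) (t_corner j) c &
    A = fill (segment (s_corner j) (crossing I)
              `|` segment (t_corner j) (crossing I)
              `|` trace (s_corner j) c)].

(* rho i = A_j means that robot i is put in the set R_j; a route contained in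
   two regions runs along their common boundary and may go to either. *)
Definition region_assignment (rho : 'I_n.+1 -> region_name) : Prop :=
  forall i, exists2 A, is_region (rho i) A & route i `<=` A.

End Regions.

(* A step: its duration and the velocity of every robot (0 when at rest). *)
Definition step (R : realType) (n : nat) : Type :=
  (R * {ffun 'I_n -> point R})%type.

Definition schedule (R : realType) (n : nat) : Type := seq (step R n).

Section Schedules.
Variables (R : realType) (n m : nat).
Implicit Types (I : instance R n m) (sch : schedule R n) (st : step R n).

Definition advance (i : 'I_n) (x : point R) st : point R := x + st.1 *: st.2 i.

Definition position I sch (i : 'I_n) : point R :=
  foldl (advance i) (start I i) sch.

Definition waypoints I sch (i : 'I_n) : seq (point R) :=
  scanl (advance i) (start I i) sch.

(* Consecutive steps have different velocities, so that every entry is a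
   maximal period of constant motion. *)
Definition well_formed sch : Prop :=
  all (fun st => 0 < st.1) sch /\ sorted (fun st st' => st.2 != st'.2) sch.

(* Covering the shortest path with a motion of the same length means walking
   along it from start to target without going back. *)
Definition follows_path I sch (i : 'I_n) : Prop :=
  [/\ position I sch i = target I i,
      trace (start I i) (waypoints I sch i) = trace (start I i) (spath I i) &
      len (start I i) (waypoints I sch i) = len (start I i) (spath I i)].

Definition keeps_visibility I sch : Prop :=
  forall sch1 st sch2, sch = sch1 ++ st :: sch2 ->
  forall u : R, 0 <= u <= st.1 ->
  forall i j, visible (polygon (vertex I))
    (position I sch1 i + u *: st.2 i) (position I sch1 j + u *: st.2 j).

Definition solves I sch : Prop :=
  [/\ well_formed sch, forall i, follows_path I sch i & keeps_visibility I sch].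

Definition number_of_steps sch : nat := size sch.

Definition moves_R1_R3_together (rho : 'I_n -> region_name) st : Prop :=
  forall i, rho i = A1 \/ rho i = A3 -> st.2 i != 0.

Definition never_moves_R1_R3_together (rho : 'I_n -> region_name) sch : Prop :=
  forall st, st \in sch -> ~ moves_R1_R3_together rho st.

End Schedules.

(* Main.v *)
From HB Require Import structures.
From mathcomp Require Import all_boot all_order all_algebra all_fingroup.
From mathcomp Require Import all_classical all_reals all_analysis.
From mathcomp Require Import ring lra.
Require Import Defs.

(* Two robots walk along the vertical sides of a bow-tie shaped hexagon whose
   waist is the segment from (0,-e) to (0,e): one from (-1,1) down to (-1,-1),
   the other from (1,-1) up to (1,1).  Their line of sight crosses x = 0 at half
   the sum of their heights, so this sum stays in [-2e, 2e].  In a step that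
   moves only one robot, that robot therefore travels at most 4e, and 1/(2e)
   steps are needed while n = 2 and m = 6.  Moving the robots alternately by 2e
   is possible.  The minimal polygon Q is bounded by S, T and the two routes; A1
   and A3 are its left and right triangles, and a shortest path bounding A2 or
   A4 is too short to reach the opposite height, so no route lies in A2 or A4. *)

Set Implicit Arguments.
Unset Strict Implicit.
Unset Printing Implicit Defensive.

Import Order.TTheory GRing.Theory Num.Theory.
Import numFieldNormedType.Exports.

Local Open Scope classical_set_scope.
Local Open Scope ring_scope.

(* Typing the coordinates in R rather than R^o keeps lra applicable. *)
Definition pt (R : realType) (a b : R) : point R := (a, b).

(** * Filled regions: monotonicity, idempotence, and tests for membership *)

Section Plane.
Variable R : realType.
Implicit Types (B D : set (point R)) (p : seq (point R)).

Lemma sub_bounded_set B D : B `<=` D -> bounded_set D -> bounded_set B.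
Proof.
move=> BD; rewrite /bounded_set /bounded_near/=.
by apply: filterS => M bD x /BD; exact: bD.
Qed.

Lemma sub_fill B : B `<=` fill B.
Proof. by move=> x; left. Qed.

Lemma fill_mono B D : B `<=` D -> fill B `<=` fill D.
Proof.
move=> BD x; have [Dx _|nDx [/BD//|Cx]] := pselect (D x); first by left.
right; apply: sub_bounded_set Cx; apply: connected_component_max => //.
- exact: connected_component_refl.
- move=> y /connected_component_sub nDy; exact: contra_not (@BD y) nDy.
- exact: component_connected.
Qed.

(** If [x] is outside [fill B], every point of its component in the complement of [B] shares that
    component and so is outside [fill B] too. The component thus lies in the one around [x] in the
    complement of [fill B], and inherits its boundedness. *)
Lemma fill_fill B : fill (fill B) `<=` fill B.
Proof.
move=> x [//|Cx]; have [Bx|nBx] := pselect (B x); first by left.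
right; have [fx|nfx] := pselect (fill B x); first by case: fx.
apply: sub_bounded_set Cx.
apply: connected_component_max => //.
- exact: connected_component_refl.
- move=> y xy [By|Cy]; first exact: (connected_component_sub xy).
  by apply: nfx; right; rewrite (same_connected_component xy).
- exact: component_connected.
Qed.

(** The ray is connected and avoids [B], so it lies in the component of [x], which is therefore
    unbounded. *)
Lemma ray_notin_fill B (x d : point R) : d != 0 ->
  (forall t : R, 0 <= t -> ~ B (x + t *: d)) -> ~ fill B x.
Proof.
move=> d0 ray [Bx|].
  by apply: (ray 0) => //; rewrite scale0r addr0.
move=> /ex_strict_bound_gt0 [M _ /= bM].
pose f (t : R^o) : point R := x + t *: d.
have sub : f @` `[0, +oo[ `<=` connected_component (~` B) x.
  apply: connected_component_max.
  - by exists 0; rewrite /= ?in_itv/= ?lexx// /f scale0r addr0.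
  - by move=> _ [t /= + <-]; rewrite in_itv/= andbT => /ray.
  - apply: connected_continuous_connected.
      by apply/connected_intervalP; exact: interval_is_interval.
    apply: continuous_subspaceT => t; rewrite /f.
    by apply: cvgD; [exact: cvg_cst | apply: cvgZr_tmp; exact: cvg_id].
have nd : 0 < `|d| by rewrite normr_gt0.
(* With this [t] the vector [t *: d] has norm [|x| + |M| + 1], which leaves at least [|M| + 1] for
   the point on the ray. *)
pose t := (`|x| + `|M| + 1) / `|d|.
have t0 : 0 <= t by rewrite divr_ge0// !addr_ge0.
have /sub/bM/= : (f @` `[0, +oo[) (f t).
  by exists t => //=; rewrite in_itv/= t0.
apply/negP; rewrite -leNgt /f.
have : `|t *: d| <= `|x + t *: d| + `|x|.
  by rewrite -{1}(addKr x (t *: d)) addrC (le_trans (ler_normB _ _))// addrC.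
rewrite normrZ (ger0_norm t0) divfK ?gt_eqF//.
have := ler_norm M; lra.
Qed.

(** By the intermediate value theorem, a component of the complement of [B] that contains both [x]
    and a point with [f > 0] would contain a zero of [f], hence a point of [B]. *)
Lemma fill_sublevel B (f : point R -> R) :
  continuous (f : point R -> R^o) -> bounded_set [set x | f x <= 0] ->
  (forall x, f x = 0 -> B x) -> forall x, f x <= 0 -> fill B x.
Proof.
move=> cf bf f0 x fx; have [|nBx] := pselect (B x); first by left.
right; apply: sub_bounded_set bf => y xy /=; rewrite leNgt; apply/negP => fy.
have /connected_intervalP : 
    connected ((f : point R -> R^o) @` connected_component (~` B) x).
  apply: connected_continuous_connected; first exact: component_connected.
  exact: continuous_subspaceT.
move=> /(_ (f x) (f y)) /(_ _ _ 0)[].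
- by exists x => //; exact: connected_component_refl.
- by exists y.
- by rewrite fx ltW.
by move=> z /connected_component_sub nBz /f0.
Qed.

End Plane.

(** * Segments, Euclidean distance and polygonal paths *)

Section Paths.
Variable R : realType.
Implicit Types (x y z d : point R) (D : set (point R)) (p : seq (point R)).

Lemma segmentP x y z : segment x y z <->
  exists l : R, [/\ 0 <= l, l <= 1, z.1 = x.1 + l * (y.1 - x.1) &
    z.2 = x.2 + l * (y.2 - x.2)].
Proof.
split=> [[l /= + <-]|[l [l0 l1 z1 z2]]].
  by rewrite in_itv/= => /andP[l0 l1]; exists l.
by exists l; rewrite /= ?in_itv/= ?l0//; case: z z1 z2 => /= ? ? -> ->.
Qed.

Lemma segment_left x y : segment x y x.
Proof. by apply/segmentP; exists 0; split; rewrite ?ler01// mul0r addr0. Qed.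

Lemma segment_right x y : segment x y y.
Proof. by apply/segmentP; exists 1; split; rewrite ?ler01// mul1r subrKC. Qed.

Lemma segmentC x y : segment x y = segment y x.
Proof.
suff sub u v : @segment R u v `<=` segment v u by apply/seteqP; split; exact: sub.
move=> z /segmentP[l [l0 l1 z1 z2]]; apply/segmentP; exists (1 - l); split.
- lra.
- lra.
- by rewrite z1; ring.
- by rewrite z2; ring.
Qed.

Lemma segment_xx x : segment x x = [set x].
Proof.
apply/seteqP; split=> [z|_ ->]; last exact: segment_left.
by move=> [l _ <-]; rewrite subrr scaler0 addr0.
Qed.

Lemma segment_subset x y z : segment x y z -> segment x z `<=` segment x y.
Proof.
move=> /segmentP[k [k0 k1 z1 z2]] w /segmentP[l [l0 l1 w1 w2]].
apply/segmentP; exists (l * k); split.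
- by rewrite mulr_ge0.
- by rewrite mulr_ile1.
- by rewrite w1 z1; ring.
- by rewrite w2 z2; ring.
Qed.

(** Eliminating the parameter of a non-vertical segment leaves constraints that linear arithmetic
    can handle. *)
Lemma segment_graph x y z : x.1 < y.1 -> segment x y z <->
  [/\ x.1 <= z.1, z.1 <= y.1 &
    (z.2 - x.2) * (y.1 - x.1) = (z.1 - x.1) * (y.2 - x.2)].
Proof.
move=> xy; have d0 : 0 < y.1 - x.1 by rewrite subr_gt0.
split=> [/segmentP[l [l0 l1 z1 z2]]|[xz zy E]].
  by rewrite z1 z2; split; [nra|nra|ring].
apply/segmentP; exists ((z.1 - x.1) / (y.1 - x.1)); split.
- by rewrite divr_ge0 ?subr_ge0// ltW.
- by rewrite ler_pdivrMr// mul1r lerD2r.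
- by rewrite divfK ?gt_eqF// subrKC.
- by rewrite mulrAC -E mulfK ?gt_eqF// subrKC.
Qed.

Lemma le_dist x y (r : R) : 0 <= r ->
  (dist x y <= r) = ((x.1 - y.1) ^+ 2 + (x.2 - y.2) ^+ 2 <= r ^+ 2).
Proof.
move=> r0; rewrite -[in LHS](ger0_norm r0) -sqrtr_sqr /dist.
by rewrite ler_sqrt ?sqr_ge0.
Qed.

Lemma dist_ge0 x y : 0 <= dist x y.
Proof. exact: sqrtr_ge0. Qed.

Lemma sqr_dist x y : dist x y ^+ 2 = (x.1 - y.1) ^+ 2 + (x.2 - y.2) ^+ 2.
Proof. by rewrite sqr_sqrtr// addr_ge0// sqr_ge0. Qed.

Lemma distC x y : dist x y = dist y x.
Proof. by rewrite /dist -sqrrN opprB -[X in _ + X]sqrrN opprB. Qed.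

Lemma dist_triangle y x z : dist x z <= dist x y + dist y z.
Proof.
rewrite le_dist ?addr_ge0 ?dist_ge0// [leRHS]sqrrD !sqr_dist.
set a := x.1 - y.1; set b := x.2 - y.2; set c := y.1 - z.1; set e := y.2 - z.2.
have -> : x.1 - z.1 = a + c by rewrite /a /c; ring.
have -> : x.2 - z.2 = b + e by rewrite /b /e; ring.
suff : a * c + b * e <= dist x y * dist y z by rewrite -mulr_natl; lra.
rewrite (le_trans (ler_norm _))// -ler_sqr ?nnegrE ?mulr_ge0 ?dist_ge0//.
rewrite real_normK ?num_real// exprMn !sqr_dist -/a -/b -/c -/e.
(* Cauchy-Schwarz: by Lagrange's identity this square is the difference of the two sides. *)
by have := sqr_ge0 (a * e - b * c); lra.
Qed.

Lemma dist_scale (l : R) x y z w :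
  0 <= l -> z - w = l *: (x - y) -> dist z w = l * dist x y.
Proof.
move=> l0 zw; rewrite /dist -[l in RHS]ger0_norm// -sqrtr_sqr -sqrtrM ?sqr_ge0//.
rewrite (_ : z.1 - w.1 = (z - w).1)// (_ : z.2 - w.2 = (z - w).2)// zw.
by congr Num.sqrt => /=; rewrite /GRing.scale/=; ring.
Qed.

Lemma dist_segment x y z : segment x y z -> dist x z + dist z y = dist x y.
Proof.
move=> [l /=]; rewrite in_itv/= => /andP[l0 l1] <-.
have -> : dist x (x + l *: (y - x)) = l * dist x y.
  by apply: dist_scale => //; rewrite opprD addNKr -scalerN opprB.
have -> : dist (x + l *: (y - x)) y = (1 - l) * dist x y.
  apply: dist_scale; rewrite ?subr_ge0//.
  by rewrite scalerBl scale1r -scalerN opprB addrAC.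
by ring.
Qed.

Lemma dist_le_len x p : dist x (last x p) <= len x p.
Proof.
elim: p x => [|y p ih] x /=.
  by rewrite /dist !subrr expr0n addr0 sqrtr0.
by rewrite (le_trans (dist_triangle y _ _))// lerD2l.
Qed.

(** This is what makes a path expensive when it visits a far point [z], even if [z] is not one of
    its vertices. *)
Lemma dist_trace x p z : trace x p z -> dist x z + dist z (last x p) <= len x p.
Proof.
elim: p x => [|y p ih] x /=.
  by move=> ->; rewrite /dist !subrr expr0n addr0 sqrtr0 addr0.
case=> [/dist_segment <-|/ih zp].
  have := dist_triangle y z (last y p); have := dist_le_len y p; lra.
have := dist_triangle y x z; lra.
Qed.

Lemma trace_mem x p z : z \in x :: p -> trace x p z.
Proof.
elim: p x => [|y p ih] x; first by rewrite inE => /eqP.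
rewrite inE => /predU1P[->|/ih]; first by left; exact: segment_left.
by right.
Qed.

Lemma trace1 x y : trace x [:: y] = segment x y.
Proof. by apply/seteqP; split => [z [//|->]|z]; [exact: segment_right | left]. Qed.

Lemma straight_shortest_path D x y :
  segment x y `<=` D -> shortest_path D x y [:: y].
Proof.
move=> xyD; split=> [//||p <- _]; first by rewrite trace1.
by rewrite /= addr0 dist_le_len.
Qed.

Lemma dist_ge_height x y : `|x.2 - y.2| <= dist x y.
Proof.
by rewrite -sqrtr_sqr ler_sqrt ?addr_ge0 ?sqr_ge0// lerDr sqr_ge0.
Qed.

Lemma dist_collinear x d (a b c : R) : a <= b <= c ->
  dist (x + a *: d) (x + c *: d) =
  dist (x + a *: d) (x + b *: d) + dist (x + b *: d) (x + c *: d).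
Proof.
have E s t : s <= t -> dist (x + s *: d) (x + t *: d) = (t - s) * dist 0 d.
  rewrite -subr_ge0 => /dist_scale; apply.
  by rewrite opprD addrACA subrr add0r -scalerBl sub0r scalerN -scaleNr opprB.
by move=> /andP[ab bc]; rewrite !E ?(le_trans ab)//; ring.
Qed.

Lemma segment_collinear x d (a b c : R) : a <= b <= c ->
  segment (x + a *: d) (x + c *: d) =
  segment (x + a *: d) (x + b *: d) `|` segment (x + b *: d) (x + c *: d).
Proof.
have E s t : s <= t -> segment (x + s *: d) (x + t *: d) =
    [set x + u *: d | u in `[s, t]].
  (* The change of parameter below divides by [t - s], hence the separate degenerate case. *)
  rewrite le_eqVlt => /predU1P[->|st].
    rewrite segment_xx; apply/seteqP; split=> z; rewrite set_itv1 image_set1//.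
  apply/seteqP; split=> w [l /=]; rewrite in_itv/= => /andP[l0 l1] <-.
    exists (s + l * (t - s)).
      by rewrite /= in_itv/=; apply/andP; split; nra.
    by rewrite opprD addrACA subrr add0r -scalerBl scalerA -addrA -scalerDl.
  have ts : 0 < t - s by rewrite subr_gt0.
  exists ((l - s) / (t - s)).
    by rewrite /= in_itv/= divr_ge0 ?ler_pdivrMr ?mul1r ?lerD2r// ?subr_ge0// ltW.
  rewrite opprD addrACA subrr add0r -scalerBl scalerA -addrA -scalerDl.
  by rewrite divfK ?gt_eqF// subrKC.
move=> /andP[ab bc]; rewrite !E ?(le_trans ab)// -image_setU.
congr image; apply/seteqP; split=> u /=; rewrite !in_itv/=.
  by move=> /andP[au uc]; have [ub|/ltW bu] := leP u b; [left|right]; apply/andP.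
by case=> /andP[h1 h2]; apply/andP; split=> //; lra.
Qed.

End Paths.

(** * The hexagon with a narrow waist and visibility inside it *)

Section Hexagon.
Variables (R : realType) (e : R).
Implicit Types (x y z : point R) (i : 'I_2).

Definition hexagon (k : 'I_6) : point R :=
  nth 0 [:: pt (-1) 1; pt 0 e; pt 1 1; pt 1 (-1); pt 0 (-e); pt (-1) (-1)] k.

Lemma hexagon_edgeP k z : edge hexagon k z <->
  nth False
    [:: [/\ -1 <= z.1, z.1 <= 0 & z.2 = e - (1 - e) * z.1];
        [/\ 0 <= z.1, z.1 <= 1 & z.2 = e + (1 - e) * z.1];
        [/\ z.1 = 1, -1 <= z.2 & z.2 <= 1];
        [/\ 0 <= z.1, z.1 <= 1 & z.2 = - e - (1 - e) * z.1];
        [/\ -1 <= z.1, z.1 <= 0 & z.2 = - e + (1 - e) * z.1];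
        [/\ z.1 = -1, -1 <= z.2 & z.2 <= 1]] k.
Proof.
case: k => -[|[|[|[|[|[|//]]]]]] lk; rewrite /edge /hexagon /=.
- by rewrite segment_graph/=; [split=> -[? ? ?]; split=> //; lra | lra].
- by rewrite segment_graph/=; [split=> -[? ? ?]; split=> //; lra | lra].
- rewrite segmentP/=; split=> [[l [l0 l1 -> ->]]|[-> ? ?]]; first by split; lra.
  by exists ((1 - z.2) / 2); split; lra.
- rewrite segmentC segment_graph/=; last lra.
  by split=> -[? ? ?]; split=> //; lra.
- rewrite segmentC segment_graph/=; last lra.
  by split=> -[? ? ?]; split=> //; lra.
- rewrite segmentP/=; split=> [[l [l0 l1 -> ->]]|[-> ? ?]]; first by split; lra.
  by exists ((1 + z.2) / 2); split; lra.
Qed.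

Lemma hexagon_simple : 0 < e -> e < 1 -> simple_polygon hexagon.
Proof.
move=> e_gt0 e_lt1; split=> //.
- have pair_inj (u v w t : R) : pt u v = pt w t -> u = w /\ v = t.
    by case=> -> ->.
  move=> i j; rewrite /hexagon.
  case: i => -[|[|[|[|[|[|//]]]]]] li; case: j => -[|[|[|[|[|[|//]]]]]] lj /=;
  first [by move=> _; exact: val_inj | by move=> /pair_inj[? ?]; exfalso; lra].
- move=> i j [a b] ij /hexagon_edgeP + /hexagon_edgeP; move: ij; rewrite /hexagon.
  have pair_eq (u v w t : R) : u = w -> v = t -> pt u v = pt w t.
    by move=> -> ->.
  (* Thirty ordered pairs of distinct edges remain: adjacent edges share only their common vertex,
     and the constraints of the other pairs are contradictory. *)
  case: i => -[|[|[|[|[|[|//]]]]]] li; case: j => -[|[|[|[|[|[|//]]]]]] lj //= _;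
  case=> ? ? ?; case=> ? ? ?;
  first [ by left; split; [exact: val_inj | apply: pair_eq; nra]
        | by right; split; [exact: val_inj | apply: pair_eq; nra]
        | exfalso; nra ].
Qed.

Lemma hexagon_inside z : 0 < e -> e < 1 -> `|z.1| <= 1 ->
  `|z.2| <= e + (1 - e) * `|z.1| ->
  polygon hexagon z.
Proof.
move=> e_gt0 e_lt1 z1 z2.
(* The hexagon is the set where both [g] and [h] are nonpositive; [g] vanishes on the vertical sides
   and [h] on the slanted ones. Their maximum is the function for [fill_sublevel]. *)
pose g z : R := `|z.1| - 1; pose h z : R := `|z.2| - (e + (1 - e) * `|z.1|).
pose f z : R := Num.max (g z) (h z).
apply: (@fill_sublevel R _ f).
- have c1 (w : point R) : (`|v.1| : R^o) @[v --> w] --> (`|w.1| : R^o).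
    by apply: (@cvg_norm _ R^o); exact: cvg_fst.
  have c2 (w : point R) : (`|v.2| : R^o) @[v --> w] --> (`|w.2| : R^o).
    by apply: (@cvg_norm _ R^o); exact: cvg_snd.
  move=> w; apply: (@continuous_max R _ (g : point R -> R^o) (h : point R -> R^o)).
    by apply: cvgB (c1 w) _; exact: cvg_cst.
  apply: cvgB (c2 w) _; apply: cvgD; first exact: cvg_cst.
  by apply: cvgM; [exact: cvg_cst|exact: c1].
- exists 1; split=> // M M1 w /=; rewrite /f /g /h ge_max => /andP[w1 w2].
  by rewrite prod_normE ge_max; apply/andP; split; nra.
- move=> w fw; have : [/\ g w <= 0, h w <= 0 & g w = 0 \/ h w = 0].
    have [gh|/ltW hg] := leP (g w) (h w); move: fw; rewrite /f.
      by rewrite (max_r gh) => hw;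
        split; [move: gh; rewrite hw | rewrite hw | right].
    by rewrite (max_l hg) => gw;
      split; [rewrite gw | move: hg; rewrite gw | left].
  have inB k (lk : (k < 6)%N) : edge hexagon (Ordinal lk) w ->
    (\bigcup_k edge hexagon k) w by exists (Ordinal lk).
  rewrite /g /h => -[].
  (* In each quadrant one vertical and one slanted edge are the candidates. *)
  case: (ger0P w.1) => w1; case: (ger0P w.2) => w2 gw hw gh.
  + have [?|?] : w.1 = 1 \/ w.2 = e + (1 - e) * w.1
      by case: gh; [left|right]; lra.
      by apply: (inB 2%N) => //; apply/hexagon_edgeP; split=> //; nra.
    by apply: (inB 1%N) => //; apply/hexagon_edgeP; split=> //; nra.
  + have [?|?] : w.1 = 1 \/ w.2 = - e - (1 - e) * w.1
      by case: gh; [left|right]; lra.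
      by apply: (inB 2%N) => //; apply/hexagon_edgeP; split=> //; nra.
    by apply: (inB 3%N) => //; apply/hexagon_edgeP; split=> //; nra.
  + have [?|?] : w.1 = -1 \/ w.2 = e - (1 - e) * w.1
      by case: gh; [left|right]; lra.
      by apply: (inB 5%N) => //; apply/hexagon_edgeP; split=> //; nra.
    by apply: (inB 0%N) => //; apply/hexagon_edgeP; split=> //; nra.
  + have [?|?] : w.1 = -1 \/ w.2 = - e + (1 - e) * w.1
      by case: gh; [left|right]; lra.
      by apply: (inB 5%N) => //; apply/hexagon_edgeP; split=> //; nra.
    by apply: (inB 4%N) => //; apply/hexagon_edgeP; split=> //; nra.
- by rewrite /f ge_max !subr_le0 z1.
Qed.

(** A segment between opposite sides has its midpoint on the waist. On each half the height and the
    bound [e + (1 - e) * |z.1|] are affine in the parameter, so checking the endpoint and the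
    midpoint suffices. *)
Lemma hexagon_visible x y : 0 < e -> e < 1 ->
  `|x.1| = 1 -> `|y.1| = 1 -> `|x.2| <= 1 -> `|y.2| <= 1 ->
  (x.1 = y.1 \/ x.1 = - y.1 /\ `|x.2 + y.2| <= 2 * e) ->
  visible (polygon hexagon) x y.
Proof.
move=> e_gt0 e_lt1 x1 y1 x2 y2 xy z /segmentP[l [l0 l1 z1 z2]].
have {}x2 : - 1 <= x.2 <= 1 by rewrite -ler_norml.
have {}y2 : - 1 <= y.2 <= 1 by rewrite -ler_norml.
case: xy => [xy|[xy]].
  have {}z1 : z.1 = x.1 by rewrite z1 xy subrr mulr0 addr0.
  apply: (hexagon_inside e_gt0 e_lt1); rewrite z1 x1// ler_norml.
  by apply/andP; split; nra.
rewrite ler_norml => xy2.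
have {}z1 : `|z.1| = `|1 - 2 * l|.
  rewrite (_ : z.1 = (2 * l - 1) * y.1); last by rewrite z1 xy; ring.
  by rewrite normrM y1 mulr1 distrC.
apply: (hexagon_inside e_gt0 e_lt1); rewrite z1.
  by rewrite ler_norml; apply/andP; split; lra.
rewrite ler_norml z2; have [l2|l2] := leP (2 * l) 1.
  rewrite ger0_norm; last by lra.
  by apply/andP; split; nra.
rewrite ler0_norm; last by lra.
by apply/andP; split; nra.
Qed.

(** The boundary meets the line x = 0 only at heights [e] and [- e], so from a point beyond the
    waist the vertical ray away from the origin escapes. *)
Lemma hexagon_waist (y : R) : 0 < e -> polygon hexagon (pt 0 y) -> `|y| <= e.
Proof.
move=> e_gt0; apply: contraPT; rewrite -ltNge => ey.
apply: (@ray_notin_fill R _ _ (pt 0 y)).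
  by apply/eqP => -[y0]; move: ey; rewrite y0 normr0; lra.
move=> t t0 [k _ /hexagon_edgeP].
have -> : (pt 0 y) + t *: (pt 0 y) = pt 0 ((1 + t) * y).
  by congr pair => /=; rewrite /GRing.scale/=; ring.
move: ey; rewrite lter_normr => ey.
case: k => -[|[|[|[|[|[|//]]]]]] lk /= [? ? ?]; try lra; case/orP: ey => ?; nra.
Qed.

Lemma visible_waist (a b : R) : 0 < e ->
  visible (polygon hexagon) (pt (-1) a) (pt 1 b) ->
  `|a + b| <= 2 * e.
Proof.
move=> e_gt0 vis.
suff /(hexagon_waist e_gt0) : polygon hexagon (pt 0 ((a + b) / 2)).
  by rewrite normrM [ `|2^-1|]gtr0_norm ?invr_gt0//; lra.
by apply: vis; apply/segmentP; exists (1 / 2); split => /=; lra.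
Qed.

End Hexagon.

(** * The instance with two robots, its minimal polygon and its regions *)

Section Bowtie.
Variables (R : realType) (e : R).
Implicit Types (i : 'I_2).

(** This sign serves twice: as the abscissa of robot [i] and as the vertical direction of its
    motion. *)
Definition side i : R := if i == ord0 then -1 else 1.
Definition bow_start i : point R := pt (side i) (- side i).
Definition bow_target i : point R := pt (side i) (side i).

Lemma I2_cases (P : 'I_2 -> Prop) : P ord0 -> P ord_max -> forall i, P i.
Proof.
by move=> P0 P1 [[|[|//]] li]; [move: P0 | move: P1]; congr P; exact: val_inj.
Qed.

Lemma norm_side i : `|side i| = 1.
Proof. by move: i; apply: I2_cases; rewrite /side/= ?normrN normr1. Qed.

Lemma side_visible i j (a b : R) : 0 < e -> e < 1 ->
  `|a| <= 1 -> `|b| <= 1 -> (i != j -> `|a + b| <= 2 * e) ->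
  visible (polygon (hexagon e)) (pt (side i) a) (pt (side j) b).
Proof.
move=> e_gt0 e_lt1 a1 b1 ab.
apply: hexagon_visible; rewrite /= ?norm_side// {a1 b1}; move: i j ab.
 do 2 apply: I2_cases; rewrite ?eqxx /= => ab; try by left.
  by right; split; [|exact: ab].
by right; split; [rewrite /side/= opprK|exact: ab].
Qed.

Hypotheses (e_gt0 : 0 < e) (e_lt1 : e < 1).

Let S_in : segment (bow_start ord0) (bow_start ord_max) `<=` polygon (hexagon e).
Proof.
apply: side_visible; rewrite ?normrN ?norm_side ?normr1// => _.
by rewrite /side/= opprK addrN normr0 mulr_ge0// ltW.
Qed.

Let T_in : segment (bow_target ord_max) (bow_target ord0) `<=` polygon (hexagon e).
Proof.
apply: side_visible; rewrite ?normrN ?norm_side ?normr1// => _.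
by rewrite /side/= addrN normr0 mulr_ge0// ltW.
Qed.

Let route_in i : segment (bow_start i) (bow_target i) `<=` polygon (hexagon e).
Proof.
by apply: side_visible; rewrite ?normrN ?norm_side ?normr1 ?eqxx.
Qed.

Let S_T_cross : segment (bow_start ord0) (bow_start ord_max) `&`
  segment (bow_target ord_max) (bow_target ord0) = [set pt 0 0].
Proof.
apply/seteqP; split=> [[a b]|_ ->].
  case=> /segmentP[l [_ _ /= a1 b1]] /segmentP[k [_ _ /= a2 b2]].
  rewrite /side/= in a1 b1 a2 b2.
  have -> : a = 0 by lra.
  by have -> : b = 0 by lra.
by split; apply/segmentP; exists (1 / 2); split; rewrite /= /side/=; lra.
Qed.

Let start_along : ordered_along (bow_start ord0) (bow_start ord_max) bow_start.
Proof.
split; first by apply: I2_cases; [exact: segment_left | exact: segment_right].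
by do 2 apply: I2_cases => //; move=> _;
  [exact: segment_left | exact: segment_left | exact: segment_right].
Qed.

(** The robot that starts lowest on S ends highest on T, hence the transposition. *)
Let target_along : ordered_along (bow_target ord_max) (bow_target ord0)
  (bow_target \o tperm ord0 ord_max).
Proof.
split.
  by apply: I2_cases => /=; rewrite ?tpermL ?tpermR;
    [exact: segment_left | exact: segment_right].
by do 2 apply: I2_cases => //; move=> _ /=; rewrite ?tpermL ?tpermR;
  [exact: segment_left | exact: segment_left | exact: segment_right].
Qed.

Let S_proper : bow_start ord0 != bow_start ord_max.
Proof. by apply/eqP => -[]; rewrite /side/=; lra. Qed.

Let T_proper : bow_target ord_max != bow_target ord0.
Proof. by apply/eqP => -[]; rewrite /side/=; lra. Qed.

Let S_height : (bow_start ord_max).2 <= (bow_start ord0).2.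
Proof. by rewrite /= /side/=; lra. Qed.

Let T_height : (bow_target ord0).2 <= (bow_target ord_max).2.
Proof. by rewrite /= /side/=; lra. Qed.

Definition bowtie : instance R 2 6 :=
  @Instance R 2 6 (hexagon e)
    (bow_start ord0) (bow_start ord_max) (bow_target ord_max) (bow_target ord0)
    (pt 0 0) bow_start bow_target (tperm ord0 ord_max)
    (fun i => [:: bow_target i])
    (hexagon_simple e_gt0 e_lt1) S_proper T_proper S_height T_height
    S_in T_in S_T_cross start_along target_along
    (fun i => straight_shortest_path (@route_in i)).

(** In this vertex order the closed curve follows S, the right route, T and the left route
    backwards. It crosses itself at the origin, which [degenerate_polygon] allows. *)
Definition bow_Q : set (point R) :=
  polygon (fun k : 'I_4 => nth 0 [:: bow_start ord0; bow_start ord_max;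
                                     bow_target ord_max; bow_target ord0] k).

Let S_Q : segment (bow_start ord0) (bow_start ord_max) `<=` bow_Q.
Proof.
by apply: subset_trans (@sub_fill _ _) => z; exists (Ordinal (isT : 0 < 4)%N).
Qed.

Let T_Q : segment (bow_target ord_max) (bow_target ord0) `<=` bow_Q.
Proof.
by apply: subset_trans (@sub_fill _ _) => z; exists (Ordinal (isT : 2 < 4)%N).
Qed.

Let route_Q i : route bowtie i `<=` bow_Q.
Proof.
rewrite /route trace1; apply: subset_trans (@sub_fill _ _) => z; move: i.
apply: I2_cases => /= hz; last by exists (Ordinal (isT : 1 < 4)%N).
by exists (Ordinal (isT : 3 < 4)%N); rewrite // /edge /= segmentC.
Qed.

(* The boundary curve of bow_Q is exactly the union of S, T and the two routes,
   so any filled set containing these contains bow_Q. *)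
Lemma bow_Q_sub D : segment (bow_start ord0) (bow_start ord_max) `<=` fill D ->
  segment (bow_target ord_max) (bow_target ord0) `<=` fill D ->
  (forall i, route bowtie i `<=` fill D) -> bow_Q `<=` fill D.
Proof.
move=> SD TD rD; apply: subset_trans (@fill_fill _ D); apply: fill_mono.
move=> z [[[|[|[|[|//]]]] lk] _]; rewrite /edge /=.
- exact: SD.
- by have := rD ord_max; rewrite /route trace1; exact.
- exact: TD.
- by have := rD ord0; rewrite /route trace1 segmentC; exact.
Qed.

(** The hexagon and every competing polygon are values of [fill], so [bow_Q_sub] yields both the
    inclusion in the hexagon and minimality. *)
Lemma bow_is_Q : is_Q bowtie bow_Q.
Proof.
split; first split=> //.
- by exists 3%N, (fun k : 'I_4 => nth 0 [:: bow_start ord0; bow_start ord_max;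
                                     bow_target ord_max; bow_target ord0] k).
- by apply: bow_Q_sub => // i; rewrite /route trace1; exact: route_in.
- by move=> _ [[m [v ->]] _ ? ? ?]; exact: bow_Q_sub.
Qed.

(** The corners of [A1] are the endpoints of the left route and those of [A3] the endpoints of the
    right one, so each route is itself the bounding chain of its region. *)
Lemma bow_region_assignment :
  region_assignment bowtie (fun i => if i == ord0 then A1 else A3).
Proof.
have sub i j : s_corner bowtie j = bow_start i ->
    t_corner bowtie j = bow_target i ->
    exists2 A, is_region bowtie j A & route bowtie i `<=` A.
  move=> si ti; exists (fill (segment (s_corner bowtie j) (crossing bowtie)
              `|` segment (t_corner bowtie j) (crossing bowtie)
              `|` trace (s_corner bowtie j) [:: t_corner bowtie j])).
    exists bow_Q, [:: t_corner bowtie j]; split=> //; first exact: bow_is_Q.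
    apply: straight_shortest_path; rewrite si ti.
    by have := @route_Q i; rewrite /route trace1.
  by apply: subset_trans (@sub_fill _ _); rewrite si ti; right.
by apply: I2_cases; apply: sub => //=; rewrite ?tpermL ?tpermR.
Qed.

End Bowtie.

(** * Points outside a region, and general facts on schedules *)

Section Steps.
Variable R : realType.

(* A path from x to y that reaches height -h has length at least 4, whereas the
   detour through the origin is shorter; so the region stays away from height -h
   and a vertical ray escapes from it. *)
Lemma region_misses Q (x y w : point R) (h : R) c :
  h ^+ 2 = 1 -> x.1 ^+ 2 = 1 -> y.1 ^+ 2 = 1 -> x.2 = h -> y.2 = h ->
  w.2 = - h -> segment x (pt 0 0) `<=` Q -> segment y (pt 0 0) `<=` Q ->
  shortest_path Q x y c ->
  ~ fill (segment x (pt 0 0) `|` segment y (pt 0 0) `|` trace x c) w.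
Proof.
move=> h2 x1 y1 xh yh wh xQ yQ [cy _ cmin].
have d_lt2 (z : point R) : z.1 ^+ 2 = 1 -> z.2 = h -> dist z (pt 0 0) < 2.
  (* The distance is the square root of 2; the rational bound 3/2 avoids the root. *)
  move=> z1 z2; apply: (@le_lt_trans _ _ (3 / 2)); last by lra.
  by rewrite le_dist/= ?subr0 ?z1 ?z2; lra.
apply: (@ray_notin_fill R _ w (pt 0 (- h))).
  by apply/eqP => -[h0]; move: h2; rewrite (_ : h = 0); lra.
move=> t t0; set z := w + _.
have z2 : z.2 = - ((1 + t) * h) by rewrite /z /= wh /GRing.scale/=; ring.
have seg (v : point R) : v.2 = h -> ~ segment v (pt 0 0) z.
  move=> vh /segmentP[l [l0 l1 _]]; rewrite z2 vh.
  rewrite (_ : (pt 0 0).2 = 0)// => E.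
  (* Multiplying by [h], whose square is 1, gives [2 + t = l], contrary to [l <= 1]. *)
  have : (2 + t - l) * h = 0 by lra.
  by move=> /(congr1 ( *%R^~ h)) /=; rewrite -mulrA -expr2 h2; lra.
case=> [[/(seg _ xh)//|/(seg _ yh)//]|/dist_trace].
have : len x c <= len x [:: pt 0 0; y].
  apply: cmin => //; rewrite (_ : trace x _ =
    segment x (pt 0 0) `|` trace (pt 0 0) [:: y])// trace1 segmentC.
  by rewrite (segmentC (pt 0 0) y) subUset; split => //; rewrite segmentC.
have far (v : point R) : v.2 = h -> 2 <= dist v z.
  move=> vh; apply: le_trans (dist_ge_height _ _).
  rewrite z2 vh (_ : h - _ = (2 + t) * h); last by ring.
  rewrite normrM (ger0_norm (_ : 0 <= 2 + t)); last by lra.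
  have -> : `|h| = 1 by apply/eqP; rewrite -sqrp_eq1// real_normK ?num_real// h2.
  by lra.
have := far _ xh; have := far _ yh; have := d_lt2 _ x1 xh; have := d_lt2 _ y1 yh.
rewrite /= cy (distC z y) (distC (pt 0 0) y) addr0; lra.
Qed.

(** All displacements are nonnegative multiples of one vector, so the motion never turns back: its
    pieces join to one segment and their lengths add up. *)
Lemma monotone_waypoints n (i : 'I_n) (d x : point R) (sch : schedule R n) :
  (forall st, st \in sch -> exists2 c : R, 0 <= c & st.1 *: st.2 i = c *: d) ->
  let y := foldl (advance i) x sch in
  [/\ exists2 c : R, 0 <= c & y = x + c *: d,
      trace x (scanl (advance i) x sch) = segment x y &
      len x (scanl (advance i) x sch) = dist x y].
Proof.
elim: sch x => [|st sch ih] x along /=.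
  split; first by exists 0 => //; rewrite scale0r addr0.
    by rewrite segment_xx.
  by rewrite /dist !subrr expr0n addr0 sqrtr0.
have [a a0 sta] := along st (mem_head _ _).
have [|[b b0 ->] -> ->] := ih (advance i x st).
  by move=> s sin; apply: along; rewrite inE sin orbT.
have -> : advance i x st = x + a *: d by rewrite /advance sta.
have ab : 0 <= a <= a + b by rewrite a0 lerDl.
rewrite -addrA -scalerDl; split; first by exists (a + b); rewrite ?addr_ge0.
  by have := segment_collinear x d ab; rewrite scale0r addr0.
by have := dist_collinear x d ab; rewrite scale0r addr0.
Qed.

Lemma position_on_route n m (I : instance R n m) sch1 sch2 i :
  follows_path I (sch1 ++ sch2) i ->
  trace (start I i) (spath I i) (position I sch1 i).
Proof.
case=> _ <- _; apply: trace_mem; rewrite /waypoints scanl_cat -cat_cons mem_cat.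
apply/orP; left; rewrite /position.
by elim: sch1 (start I i) => [|st s ih] x /=; rewrite ?mem_head// inE ih orbT.
Qed.

(** This turns the arbitrary splitting in [keeps_visibility] into an index [k]. *)
Lemma mkseq_cat_cons (T : Type) (f : nat -> T) n s1 x s2 :
  mkseq f n = s1 ++ x :: s2 ->
  exists2 k, (k < n)%N & s1 = mkseq f k /\ x = f k.
Proof.
move=> E; have lt : (size s1 < n)%N.
  have := congr1 size E; rewrite size_mkseq size_cat /= => ->.
  by rewrite addnS ltnS leq_addr.
exists (size s1) => //; split.
  have := congr1 (take (size s1)) E; rewrite take_size_cat// => {1}<-.
  by rewrite /mkseq -map_take take_iota (minn_idPl (ltnW lt)).
have := congr1 (nth x ^~ (size s1)) E.
by rewrite /= nth_mkseq// nth_cat ltnn subnn.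
Qed.

End Steps.

(** * The alternating schedule and the lower bound on the number of steps *)

Section Alternation.
Variables (R : realType) (e : R) (e_gt0 : 0 < e) (e_lt1 : e < 1).
Implicit Types (i : 'I_2) (sch : schedule R 2).

Local Notation I := (bowtie e_gt0 e_lt1).

(** Both corners of [A2] have height 1 and both corners of [A4] height -1. Each route joins these
    two heights, so it contains a point that [region_misses] excludes. *)
Lemma bow_region13 rho : region_assignment I rho ->
  forall i, rho i = A1 \/ rho i = A3.
Proof.
move=> rhoP i; have [A] := rhoP i.
suff is13 j : is_region I j A -> route I i `<=` A -> j = A1 \/ j = A3.
  exact: is13.
move=> [Q [c [[[_ _ SQ TQ _] _] cQ ->]]] iA.
have [SO TO] : segment (S_top I) (S_bot I) (pt 0 0) /\
    segment (T_top I) (T_bot I) (pt 0 0).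
  by have : [set crossing I] (crossing I) by []; rewrite -(S_meets_T I).
have hit (h : R) : h ^+ 2 = 1 -> exists2 w, route I i w & w.2 = - h.
  move=> /eqP; rewrite sqrf_eq1 => h1.
  have [<-|<-] : side R i = - h \/ - side R i = - h.
  - rewrite /side; case: ifP => _; case/orP: h1 => /eqP ->; rewrite ?opprK;
    by [left | right].
  - by exists (bow_target R i); rewrite // /route trace1; exact: segment_right.
  - by exists (bow_start R i); rewrite // /route trace1; exact: segment_left.
have side2 k : side R k ^+ 2 = 1.
  by rewrite -real_normK ?num_real// norm_side expr1n.
case: j cQ iA; [by left | | by right | ]; rewrite /= ?tpermL ?tpermR => cQ iA.
- have [w iw w2] := hit (side R ord_max) (side2 _).
  case: (@region_misses R Q _ _ w (side R ord_max) c _ _ _ _ _ _ _ _ cQ) => //=.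
  + by rewrite /side/= opprK.
  + exact: subset_trans (segment_subset SO) SQ.
  + exact: subset_trans (segment_subset TO) TQ.
  + exact: iA.
(* The corners of [A4] are the bottom ends of S and T, so both segments are reversed. *)
- rewrite segmentC in SO; rewrite segmentC in TO.
  rewrite segmentC in SQ; rewrite segmentC in TQ.
  have [w iw w2] := hit (side R ord0) (side2 _).
  case: (@region_misses R Q _ _ w (side R ord0) c _ _ _ _ _ _ _ _ cQ) => //=.
  + exact: subset_trans (segment_subset SO) SQ.
  + exact: subset_trans (segment_subset TO) TQ.
  + exact: iA.
Qed.

(** Robot [ord0] moves in the even steps, starting with step 0, and the other robot in the odd
    ones. *)
Definition bow_mover i (k : nat) : bool := odd ((i == ord0) + k).

(** This counts the moves of robot [i] in the first [k] steps. *)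
Definition bow_moves i (k : nat) : nat := ((i == ord0) + k)./2.

Definition bow_step (k : nat) : step R 2 :=
  (1, [ffun i => if bow_mover i k then pt 0 (2 * e * side R i) else 0]).

Lemma bow_movesS i k : bow_moves i k.+1 = (bow_mover i k + bow_moves i k)%N.
Proof. by rewrite /bow_moves addnS /= uphalf_half. Qed.

Lemma bow_position k i u :
  position I (mkseq bow_step k) i + u *: (bow_step k).2 i =
  pt (side R i)
    (side R i * (2 * e * ((bow_moves i k)%:R + u * (bow_mover i k)%:R) - 1)).
Proof.
have stepE n (v : R) : v *: (bow_step n).2 i =
    pt 0 (v * (bow_mover i n)%:R * (2 * e * side R i)).
  rewrite /= ffunE; case: bow_mover; rewrite ?mulr1 ?mulr0 ?mul0r ?scaler0//.
  by congr pair; rewrite /GRing.scale/= mulr0.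
have ptD (a b c d : R) : pt a b + pt c d = pt (a + c) (b + d) by [].
have -> : position I (mkseq bow_step k) i =
    pt (side R i) (side R i * (2 * e * (bow_moves i k)%:R - 1)).
  elim: k => [|k ih].
    rewrite /position /= /bow_start; congr pt.
    by rewrite /bow_moves addn0; case: eqP => _ /=; ring.
  rewrite mkseqS /position foldl_rcons -/(position I _ i) ih /advance.
  rewrite stepE ptD bow_movesS natrD /=; congr pt; ring.
by rewrite stepE ptD; congr pt; ring.
Qed.

Lemma bow_keeps_visibility K : K%:R * e = 1 ->
  keeps_visibility I (mkseq bow_step K.*2).
Proof.
move=> Ke s1 st s2 E; have [k kK [-> ->]] := mkseq_cat_cons E.
move=> {s1 s2 st E} u /andP[u0 u1] i j.
rewrite /= in u1; rewrite !bow_position.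
pose c i : R := (bow_moves i k)%:R + u * (bow_mover i k)%:R.
rewrite -!/(c _).
have c_ge0 a : 0 <= c a by rewrite addr_ge0 ?mulr_ge0.
have c_le a : c a <= K%:R.
  apply: (@le_trans _ _ (bow_moves a k.+1)%:R).
    by rewrite bow_movesS natrD [leRHS]addrC lerD2l ler_piMl.
  (* As [k < K.*2], the count is at most the half of [1 + K.*2], rounded down to [K]. *)
  rewrite ler_nat -(half_bit_double K true); apply: half_leq.
  exact: leq_add (leq_b1 _) kK.
have norm1 a : `|side R a * (2 * e * c a - 1)| <= 1.
  rewrite normrM norm_side mul1r ler_norml; apply/andP; split.
    by rewrite lerBDr addNr !mulr_ge0// ltW.
  by have := c_le a; rewrite -(ler_pM2r e_gt0) Ke; lra.
(* Robot [ord0] moves first and is ahead by at most one move; the heights sum to [2 * e] times minus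
   this lead. *)
have c01 : 0 <= c ord0 - c ord_max <= 1.
  rewrite /c /bow_moves /bow_mover /= uphalf_half natrD !add0n.
  by case: odd => /=; lra.
apply: side_visible => //.
have h01 : `|side R ord0 * (2 * e * c ord0 - 1) +
    side R ord_max * (2 * e * c ord_max - 1)| <= 2 * e.
  have e0 := e_gt0; rewrite /side/=; move: c01 => /andP[? ?].
  by rewrite ler_norml; apply/andP; split; nra.
by move: i j; do 2 apply: I2_cases => //; move=> _; rewrite // addrC.
Qed.

Lemma bow_follows_path K i : K%:R * e = 1 ->
  follows_path I (mkseq bow_step K.*2) i.
Proof.
move=> Ke.
have end_ : position I (mkseq bow_step K.*2) i = target I i.
  rewrite -[LHS]addr0 -(scale0r ((bow_step K.*2).2 i)) bow_position /=.
  rewrite /bow_target; congr pt.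
  have -> : bow_moves i K.*2 = K.
    by rewrite /bow_moves half_bit_double.
  by rewrite mul0r addr0 -mulrA [e * _]mulrC Ke; ring.
have along st : st \in mkseq bow_step K.*2 ->
    exists2 c : R, 0 <= c & st.1 *: st.2 i = c *: pt 0 (side R i).
  move=> /mapP[k _ ->] /=; rewrite scale1r ffunE; case: bow_mover.
    exists (2 * e); first by rewrite mulr_ge0// ltW.
    by congr pair; rewrite /GRing.scale/= ?mulr0.
  by exists 0; rewrite ?scale0r.
have [_ tr ln] := monotone_waypoints (start I i) along.
rewrite -/(position I _ i) end_ in tr ln.
by split; rewrite ?trace1//= addr0.
Qed.

Lemma bow_alternates K rho : region_assignment I rho ->
  never_moves_R1_R3_together rho (mkseq bow_step K).
Proof.
move=> /bow_region13 r13 st /mapP[k _ ->] all_move.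
have moves i : bow_mover i k.
  by have := all_move i (r13 i); rewrite /= ffunE; case: bow_mover; rewrite ?eqxx.
have := moves ord0; have := moves ord_max.
by rewrite /bow_mover /= add0n => ->.
Qed.

Lemma bow_solves K : K%:R * e = 1 -> solves I (mkseq bow_step K.*2).
Proof.
move=> Ke; have e0 := e_gt0; split; last exact: bow_keeps_visibility.
- split; first by apply/allP => st /mapP[k _ ->] /=; exact: ltr01.
  apply/(sortedP (bow_step 0)) => k; rewrite size_mkseq => kK.
  rewrite !nth_mkseq// ?(ltnW kK)//.
  (* Consecutive steps differ because robot [ord0] rests in exactly one of them. *)
  apply/eqP => /ffunP/(_ ord0); rewrite !ffunE /bow_mover /= negbK.
  by case: odd => /= /(congr1 snd) /=; rewrite /side/=; nra.
- by move=> i; exact: bow_follows_path.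
Qed.

Lemma bow_many_steps rho sch : region_assignment I rho -> solves I sch ->
  never_moves_R1_R3_together rho sch -> 1 <= 2 * e * (size sch)%:R.
Proof.
move=> /bow_region13 r13 [[/allP dur _] fol vis] alt.
pose h s i := (position I s i).2.
have posE s1 s2 i : sch = s1 ++ s2 -> position I s1 i = pt (side R i) (h s1 i).
  move=> E; have /position_on_route : follows_path I (s1 ++ s2) i by rewrite -E.
  rewrite trace1 => /segmentP[l [_ _ + _]] /=.
  by rewrite subrr mulr0 addr0 /h; case: position => a b /= ->.
(* Robot [ord0] must descend from height 1 to height -1, a distance of 2, at no more than [4 * e]
   per step. *)
suff main s1 s2 : sch = s1 ++ s2 -> `|h s1 ord0 - 1| <= 4 * e * (size s1)%:R.
  have := main sch [::]; rewrite cats0 => /(_ erefl).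
  have [+ _ _] := fol ord0; rewrite /h => -> /=.
  by rewrite /side/= ler_norml => /andP[? _]; lra.
elim/last_ind: s1 s2 => [|s1 st ih] s2 E.
  by rewrite /h /position /= /side /= opprK subrr normr0 mulr0.
have E1 : sch = s1 ++ st :: s2 by rewrite E cat_rcons.
have {ih} := ih _ E1.
have st_in : st \in sch by rewrite E1 mem_cat mem_head orbT.
have st0 := ltW (dur _ st_in).
have /(visible_waist e_gt0) w0 : visible (polygon (hexagon e))
    (pt (-1) (h s1 ord0)) (pt 1 (h s1 ord_max)).
  have := vis _ _ _ E1 0; rewrite lexx st0 => /(_ isT ord0 ord_max).
  by rewrite !scale0r !addr0 !(posE _ _ _ E1).
have /(visible_waist e_gt0) w1 : visible (polygon (hexagon e))
    (pt (-1) (h (rcons s1 st) ord0)) (pt 1 (h (rcons s1 st) ord_max)).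
  have := vis _ _ _ E1 st.1; rewrite lexx st0 => /(_ isT ord0 ord_max).
  have next i : position I s1 i + st.1 *: st.2 i = position I (rcons s1 st) i.
    by rewrite /position foldl_rcons.
  by rewrite !next !(posE _ _ _ E).
have rest i : st.2 i = 0 -> h (rcons s1 st) i = h s1 i.
  by move=> si; rewrite /h /position foldl_rcons /advance si scaler0 addr0.
have sizeS : (size (rcons s1 st))%:R = (size s1)%:R + 1 :> R.
  by rewrite size_rcons natr1.
(* Both robots are assigned to [A1] or [A3], so a step moving both is forbidden. *)
have [/rest r|/rest r] : st.2 ord0 = 0 \/ st.2 ord_max = 0.
- apply: contrapT => /not_orP[m0 m1]; apply: (alt _ st_in) => i _.
  by move: i; apply: I2_cases; apply/eqP.
- rewrite r sizeS => /le_trans; apply.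
  by rewrite mulrDr lerDl mulr1 mulr_ge0// ltW.
(* The height of the other robot is fixed and both sums of heights lie in [-2e, 2e], so they differ
   by at most [4 * e]. *)
- rewrite sizeS mulrDr mulr1.
  move: w0 w1; rewrite r !ler_norml => /andP[? ?] /andP[? ?] /andP[? ?].
  by apply/andP; split; lra.
Qed.

End Alternation.

Theorem lemma3p1 (R : realType) (bound : nat -> nat -> nat) :
  exists (n m : nat) (I : instance R n.+1 m),
    (exists rho, region_assignment I rho) /\
    forall rho, region_assignment I rho ->
      (exists sch, solves I sch /\ never_moves_R1_R3_together rho sch) /\
      (forall sch, solves I sch -> never_moves_R1_R3_together rho sch ->
         (bound n.+1 m < number_of_steps sch)%N).
Proof.
(* The lower bound 1/(2e) becomes K/2, which is [bound 2 6] plus one. Since 1/e is the integer [K],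
   the alternating schedule ends exactly at the targets, and [K >= 2] gives [e < 1]. *)
pose K := (bound 2 6).+1.*2; pose e : R := K%:R^-1.
have K2 : 2 <= K%:R :> R by rewrite ler_nat /K doubleS.
have e_gt0 : 0 < e by rewrite invr_gt0; lra.
have Ke : K%:R * e = 1 by rewrite mulfV//; apply/eqP; lra.
have e_lt1 : e < 1 by nra.
exists 1%N, 6%N, (bowtie e_gt0 e_lt1); split.
  by eexists; exact: bow_region_assignment.
move=> rho rhoP; split.
  exists (mkseq (bow_step e) K.*2).
  by split; [exact: bow_solves | exact: bow_alternates].
move=> sch sol alt; have := bow_many_steps rhoP sol alt.
rewrite /number_of_steps -(ler_nat R) => many.
have : K%:R = 2 * (bound 2 6).+1%:R :> R by rewrite /K -mul2n natrM.
nra.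
Qed.
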